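(* Let $M,N\in\mathbb{S}^{q+r}$. If there exist scalars $\alpha\ge 0$ and $\beta>0$ such that $M-\alpha N\ge\begin{bmatrix}\beta I_q&0\\0&0\end{bmatrix}$ ( * ), then $\mathcal{Z}_r(N)\subseteq\mathcal{Z}_r^+(M)$. Moreover, if $N\in\boldsymbol{\Pi}_{q,r}$, $M_{22}\le 0$, and $N$ has at least one positive eigenvalue, then $\mathcal{Z}_r(N)\subseteq\mathcal{Z}_r^+(M)$ if and only if there exist $\alpha\ge 0$ and $\beta>0$ such that ( * ) holds.
   Context: $\mathbb{S}^k$ denotes the real symmetric $k\times k$ matrices; for symmetric matrices, $A\ge 0$ ($A>0$) means positive semidefinite (definite), $A\le B$ means $B-A\ge0$. $A^\dagger$ is the Moore–Penrose pseudo-inverse. Any $\Pi\in\mathbb{S}^{q+r}$ (in particular $M,N$) is partitioned as $\Pi=\begin{bmatrix}\Pi_{11}&\Pi_{12}\\ \Pi_{21}&\Pi_{22}\end{bmatrix}$ with $\Pi_{11}\in\mathbb{S}^q$, $\Pi_{22}\in\mathbb{S}^r$. The generalized Schur complement is $\Pi\mid\Pi_{22}:=\Pi_{11}-\Pi_{12}\Pi_{22}^\dagger\Pi_{21}$. The set $\boldsymbol{\Pi}_{q,r}$ consists of all $\Pi\in\mathbb{S}^{q+r}$ with $\Pi_{22}\le 0$, $\Pi\mid\Pi_{22}\ge 0$ and $\ker\Pi_{22}\subseteq\ker\Pi_{12}$. Define $\mathcal{Z}_r(\Pi)=\{Z\in\mathbb{R}^{r\times q}:\begin{bmatrix}I_q\\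 Z\end{bmatrix}^\top\Pi\begin{bmatrix}I_q\\ Z\end{bmatrix}\ge 0\}$ and $\mathcal{Z}_r^+(\Pi)$ the same with $>0$. *)

(* Defs.v *)
From HB Require Import structures.
From mathcomp Require Import all_boot all_order all_algebra.
Set Implicit Arguments. Unset Strict Implicit. Unset Printing Implicit Defensive.
Import Order.TTheory GRing.Theory Num.Theory.
Local Open Scope ring_scope.

Section Defs.
Variable R : realFieldType.

Definition symmx n (A : 'M[R]_n) : Prop := A^T = A.

(* A >= 0 (positive semidefinite), for symmetric A *)
Definition psdmx n (A : 'M[R]_n) : Prop :=
  forall v : 'cV[R]_n, 0 <= (v^T *m A *m v) 0 0.

Definition pdmx n (A : 'M[R]_n) : Prop :=
  forall v : 'cV[R]_n, v != 0 -> 0 < (v^T *m A *m v) 0 0.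

Definition lemx n (A B : 'M[R]_n) : Prop := psdmx (B - A).

Definition is_pinv m n (A : 'M[R]_(m, n)) (X : 'M[R]_(n, m)) : Prop :=
  [/\ A *m X *m A = A, X *m A *m X = X,
      (A *m X)^T = A *m X & (X *m A)^T = X *m A].

Definition blk11 q r (P : 'M[R]_(q + r)) : 'M[R]_q := ulsubmx P.
Definition blk12 q r (P : 'M[R]_(q + r)) : 'M[R]_(q, r) := ursubmx P.
Definition blk21 q r (P : 'M[R]_(q + r)) : 'M[R]_(r, q) := dlsubmx P.
Definition blk22 q r (P : 'M[R]_(q + r)) : 'M[R]_r := drsubmx P.

(* the set Pi_{q,r}; the generalized Schur complement Pi|Pi22 uses the
   (unique) Moore-Penrose pseudo-inverse of Pi22 *)
Definition PiSet q r (P : 'M[R]_(q + r)) : Prop :=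
  [/\ symmx P,
      lemx (blk22 P) 0,
      (forall X : 'M[R]_r, is_pinv (blk22 P) X ->
         psdmx (blk11 P - blk12 P *m X *m blk21 P))
    & (forall v : 'cV[R]_r, blk22 P *m v = 0 -> blk12 P *m v = 0)].

Definition quadZ q r (P : 'M[R]_(q + r)) (Z : 'M[R]_(r, q)) : 'M[R]_q :=
  (col_mx (1%:M : 'M[R]_q) Z)^T *m P *m col_mx (1%:M : 'M[R]_q) Z.

Definition Zset q r (P : 'M[R]_(q + r)) : 'M[R]_(r, q) -> Prop :=
  fun Z => psdmx (quadZ P Z).
Definition Zset_pos q r (P : 'M[R]_(q + r)) : 'M[R]_(r, q) -> Prop :=
  fun Z => pdmx (quadZ P Z).

Definition star q r (M N : 'M[R]_(q + r)) (alpha beta : R) : Prop :=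
  lemx (block_mx (beta%:M : 'M[R]_q) 0 0 (0 : 'M[R]_r)) (M - alpha *: N).

End Defs.

(* Main.v *)
Require Import Defs.
From HB Require Import structures.
From mathcomp Require Import all_boot all_order all_algebra.
From mathcomp Require Import ring lra polyrcf.
From Stdlib Require Import Classical.
Import Order.TTheory GRing.Theory Num.Theory.
Local Open Scope ring_scope.

(** Completing the square in N turns a vector (v, w) with v <> 0 and N(v, w) >= 0
    into some Z in Z_r(N) with Z v = w, so the inclusion says that M is positive at
    all such vectors, and it makes M vanish on {0} x ker N22.  Adding to M the
    orthogonal projection onto that subspace gives M(x) > 0 whenever x <> 0 and
    N(x) >= 0, and a strict S-lemma, i.e. Finsler's theorem, yields alpha.

    Over a real closed field compactness is not available for Finsler's theorem,
    which is proved by induction on the dimension.  If M - aN is positive definite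
    on a hyperplane but nowhere on the whole space, then N has a constant sign on
    the nonpositive cone of each M - aN.  The vector minimising M - aN off the
    hyperplane is, up to scale, polynomial in a, so this sign persists until the
    determinant of the restricted pencil first vanishes, where the kernel vector
    has the opposite sign. *)

(** * Bilinear forms, positive semidefinite matrices and pseudo-inverses *)

Section BilinearForms.
Set Implicit Arguments.
Unset Strict Implicit.
Unset Printing Implicit Defensive.
Variable R : realFieldType.

Definition bform {n} (A : 'M[R]_n) (u v : 'cV[R]_n) : R := (u^T *m A *m v) 0 0.

Lemma bformDl n (A : 'M[R]_n) u1 u2 v :
  bform A (u1 + u2) v = bform A u1 v + bform A u2 v.
Proof. by rewrite /bform linearD /= !mulmxDl mxE. Qed.

Lemma bformDr n (A : 'M[R]_n) u v1 v2 :
  bform A u (v1 + v2) = bform A u v1 + bform A u v2.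
Proof. by rewrite /bform !mulmxDr mxE. Qed.

Lemma bformZl n (A : 'M[R]_n) a u v : bform A (a *: u) v = a * bform A u v.
Proof. by rewrite /bform linearZ /= -!scalemxAl mxE. Qed.

Lemma bformZr n (A : 'M[R]_n) a u v : bform A u (a *: v) = a * bform A u v.
Proof. by rewrite /bform -!scalemxAr mxE. Qed.

Lemma bformC n (A : 'M[R]_n) u v : symmx A -> bform A u v = bform A v u.
Proof.
move=> sA; transitivity ((u^T *m A *m v)^T 0 0); first by rewrite mxE.
by rewrite !trmx_mul trmxK sA mulmxA.
Qed.

Lemma bform_orthD n (A : 'M[R]_n) u v : symmx A -> bform A u v = 0 ->
  bform A (u + v) (u + v) = bform A u u + bform A v v.
Proof.
move=> sA uv; rewrite !(bformDl, bformDr) (bformC v u sA) uv; ring.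
Qed.

Lemma bform_pencil n (A B : 'M[R]_n) a u v :
  bform (A - a *: B) u v = bform A u v - a * bform B u v.
Proof. by rewrite /bform mulmxBr mulmxBl -scalemxAr -scalemxAl !mxE. Qed.

Lemma bform_add n (A B : 'M[R]_n) u v :
  bform (A + B) u v = bform A u v + bform B u v.
Proof. by rewrite /bform mulmxDr mulmxDl !mxE. Qed.

Lemma bform_scale n (A : 'M[R]_n) a u v :
  bform (a *: A) u v = a * bform A u v.
Proof. by rewrite /bform -scalemxAr -scalemxAl !mxE. Qed.

Lemma bform_opp n (A : 'M[R]_n) u v : bform (- A) u v = - bform A u v.
Proof. by rewrite -scaleN1r bform_scale mulN1r. Qed.

Lemma bform_congr n k (A : 'M[R]_n) (P : 'M[R]_(n, k)) u v :
  bform (P^T *m A *m P) u v = bform A (P *m u) (P *m v).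
Proof. by rewrite /bform trmx_mul !mulmxA. Qed.

Lemma bform_kerr n (A : 'M[R]_n) u v : A *m v = 0 -> bform A u v = 0.
Proof. by move=> Av; rewrite /bform -mulmxA Av mulmx0 mxE. Qed.

Lemma bform1_sum n (u : 'cV[R]_n) : bform 1%:M u u = \sum_i u i 0 ^+ 2.
Proof. by rewrite /bform mulmx1 mxE; apply: eq_bigr => i _; rewrite mxE. Qed.

Lemma bform1_ge0 n (u : 'cV[R]_n) : 0 <= bform 1%:M u u.
Proof. by rewrite bform1_sum sumr_ge0 // => i _; rewrite sqr_ge0. Qed.

Lemma bform1_eq0 n (u : 'cV[R]_n) : bform 1%:M u u = 0 -> u = 0.
Proof.
rewrite bform1_sum => /eqP; rewrite psumr_eq0; last by move=> i _; rewrite sqr_ge0.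
move=> /allP u0; apply/matrixP=> i j; rewrite ord1 mxE; apply/eqP.
by have := u0 i (mem_index_enum _); rewrite sqrf_eq0.
Qed.

Lemma bform1_gt0 n (u : 'cV[R]_n) : u != 0 -> 0 < bform 1%:M u u.
Proof.
move=> u0; rewrite lt_def bform1_ge0 andbT.
by apply: contraNneq u0 => /bform1_eq0 ->.
Qed.

Lemma bform_delta n (A : 'M[R]_n) i v :
  bform A (delta_mx i 0) v = (A *m v) i 0.
Proof. by rewrite /bform -mulmxA trmx_delta -rowE mxE. Qed.

Lemma mulmx_cV_eq0 m n (A : 'M[R]_(m, n)) :
  (forall x : 'cV[R]_n, A *m x = 0) -> A = 0.
Proof.
move=> A0; apply/matrixP=> i j; rewrite mxE.
by have /matrixP /(_ i 0) := A0 (delta_mx j 0); rewrite -colE !mxE.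
Qed.

Lemma psd_cauchy_schwarz n (A : 'M[R]_n) u v : symmx A -> psdmx A ->
  bform A u v ^+ 2 <= bform A u u * bform A v v.
Proof.
move=> sA pA.
have quad a b : 0 <= a ^+ 2 * bform A u u + 2 * a * b * bform A u v
    + b ^+ 2 * bform A v v.
  have := pA (a *: u + b *: v); rewrite -/(bform _ _ _).
  rewrite !(bformDl, bformDr, bformZl, bformZr) (bformC v u sA); lra.
have := pA v; have := pA u; rewrite -!/(bform _ _ _) => u0 v0.
have [uz|uN] := eqVneq (bform A u u) 0.
  (* With A(u,u) = 0 these coefficients give -(A(v,v) + 2) A(u,v)^2 >= 0, hence A(u,v) = 0. *)
  have := quad (- (bform A v v + 1)) (bform A u v); rewrite uz; nra.
have := quad (- bform A u v) (bform A u u).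
have -> : (- bform A u v) ^+ 2 * bform A u u + 2 * (- bform A u v) *
    bform A u u * bform A u v + bform A u u ^+ 2 * bform A v v =
  bform A u u * (bform A u u * bform A v v - bform A u v ^+ 2) by ring.
by rewrite pmulr_rge0 ?subr_ge0 // lt_def uN.
Qed.

Lemma psd_ker n (A : 'M[R]_n) u : symmx A -> psdmx A ->
  bform A u u = 0 -> A *m u = 0.
Proof.
move=> sA pA u0; apply/matrixP=> i j; rewrite ord1 [RHS]mxE -bform_delta.
apply/eqP; rewrite -sqrf_eq0 eq_le sqr_ge0 andbT.
by rewrite -(mulr0 (bform A (delta_mx i 0) (delta_mx i 0))) -u0 psd_cauchy_schwarz.
Qed.

Lemma pd_psd n (A : 'M[R]_n) : pdmx A -> psdmx A.
Proof.
move=> pA v; have [->|v0] := eqVneq v 0; last exact: ltW (pA v v0).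
by rewrite mulmx0 mxE.
Qed.

Lemma pd_det_neq0 n (A : 'M[R]_n) : pdmx A -> \det A != 0.
Proof.
move=> pA; apply/negP => /det0P [v v0 vA].
suff /pA : v^T != 0 by rewrite trmxK vA mul0mx mxE ltxx.
by rewrite -trmx0 (inj_eq trmx_inj).
Qed.

Lemma psd_det_pd n (A : 'M[R]_n) :
  symmx A -> psdmx A -> \det A != 0 -> pdmx A.
Proof.
move=> sA pA dA v v0; rewrite lt_def pA andbT -/(bform _ _ _).
apply: contraNneq dA => /(psd_ker sA pA) Av; apply/det0P; exists v^T.
  by rewrite -trmx0 (inj_eq trmx_inj).
by rewrite -[A]sA -trmx_mul Av trmx0.
Qed.

(** The Gram matrix of an injective B is positive definite, because its form at v is |B v|^2. *)
Lemma gram_unitmx m n (B : 'M[R]_(m, n)) :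
  (forall u : 'cV[R]_n, B *m u = 0 -> u = 0) -> B^T *m B \in unitmx.
Proof.
move=> injB; rewrite unitmxE unitfE; apply: pd_det_neq0 => v v0.
have -> : v^T *m (B^T *m B) *m v = (B *m v)^T *m 1%:M *m (B *m v).
  by rewrite trmx_mul mulmx1 !mulmxA.
by apply: bform1_gt0; apply: contra_neq v0; apply: injB.
Qed.

(* From a full-rank factorisation A = B C: A^+ = C^T (C C^T)^-1 (B^T B)^-1 B^T. *)
Lemma pinv_exists m n (A : 'M[R]_(m, n)) : exists X, is_pinv A X.
Proof.
have [k [B [C [AE [D DB] [E CE]]]]] : exists k (B : 'M_(m, k)) (C : 'M_(k, n)),
    [/\ B *m C = A, exists D, D *m B = 1%:M & exists E, C *m E = 1%:M].
  exists (\rank A), (col_base A), (row_base A); split.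
  - exact: mulmx_base.
  - exact/row_fullP/col_base_full.
  - exact/row_freeP/row_base_free.
have uB : B^T *m B \in unitmx.
  by apply: gram_unitmx => u Bu; rewrite -[u]mul1mx -DB -mulmxA Bu mulmx0.
have uC : C *m C^T \in unitmx.
  rewrite -{1}[C]trmxK; apply: gram_unitmx => u Cu.
  by rewrite -[u]mul1mx -[1%:M]trmx1 -CE trmx_mul -mulmxA Cu mulmx0.
set G := invmx (B^T *m B); set H := invmx (C *m C^T).
have GB l (Y : 'M_(_, l)) : G *m (B^T *m (B *m Y)) = Y.
  by rewrite (mulmxA B^T) mulmxA mulVmx // mul1mx.
have CH l (Y : 'M_(_, l)) : C *m (C^T *m (H *m Y)) = Y.
  by rewrite (mulmxA C) mulmxA mulmxV // mul1mx.
have sG : G^T = G by rewrite trmx_inv trmx_mul trmxK.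
have sH : H^T = H by rewrite trmx_inv trmx_mul trmxK.
exists (C^T *m (H *m (G *m B^T))); rewrite -AE; split.
- by rewrite -!mulmxA CH GB.
- by rewrite -!mulmxA CH GB.
- by rewrite -!mulmxA CH !trmx_mul trmxK sG mulmxA.
by rewrite -!mulmxA GB !trmx_mul trmxK sH mulmxA.
Qed.

(** Each |z_i z_j| is at most |z|^2, so the sum of all |Y_ij| serves as c. *)
Lemma bform_le_bform1 n (Y : 'M[R]_n) :
  exists2 c, 0 <= c & forall z, bform Y z z <= c * bform 1%:M z z.
Proof.
exists (\sum_i \sum_j `|Y i j|).
  by rewrite sumr_ge0 // => i _; rewrite sumr_ge0.
move=> z; set S := bform 1%:M z z.
have le k : z k 0 ^+ 2 <= S.
  rewrite /S bform1_sum (bigD1 k) //= lerDl sumr_ge0 // => l _.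
  exact: sqr_ge0.
rewrite /bform -mulmxA mxE mulr_suml; apply: ler_sum => i _.
rewrite !mxE mulr_sumr mulr_suml; apply: ler_sum => j _.
apply: le_trans (ler_norm _) _; rewrite !normrM mulrCA ler_wpM2l //.
move: (le i) (le j).
rewrite -(real_normK (num_real (z i 0))) -(real_normK (num_real (z j 0))).
move: (normr_ge0 (z i 0)) (normr_ge0 (z j 0)); nra.
Qed.

(* Write T = Q Y Q; then T(x) <= c |Q x|^2, and |Q x|^2 <= tr(Q) Q(x) by Cauchy-Schwarz. *)
Lemma psd_dominates n (Q T : 'M[R]_n) : symmx Q -> psdmx Q -> symmx T ->
  (forall x : 'cV[R]_n, Q *m x = 0 -> T *m x = 0) ->
  exists2 c, 0 < c & forall x, bform T x x <= c * bform Q x x.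
Proof.
move=> sQ pQ sT kerQT; have [X [QXQ _ _ _]] := pinv_exists Q.
have TXQ : T *m X *m Q = T.
  apply/eqP; rewrite eq_sym -subr_eq0 -[Y in Y - _]mulmx1 -mulmxA -mulmxBr.
  apply/eqP/mulmx_cV_eq0 => x; rewrite -mulmxA; apply: kerQT.
  by rewrite mulmxA mulmxBr mulmx1 mulmxA QXQ subrr mul0mx.
have QXT : Q *m X^T *m T = T.
  by have := congr1 trmx TXQ; rewrite !trmx_mul sT sQ mulmxA.
have [c c0 cY] := bform_le_bform1 (X^T *m T *m X).
have trQ0 : 0 <= \tr Q.
  by apply: sumr_ge0 => i _; have := pQ (delta_mx i 0);
     rewrite -/(bform _ _ _) bform_delta -colE mxE.
exists (c * \tr Q + 1); first by rewrite ltr_wpDl // mulr_ge0.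
move=> x; have -> : bform T x x = bform (X^T *m T *m X) (Q *m x) (Q *m x).
  by rewrite -bform_congr sQ !mulmxA QXT TXQ.
have Qx0 : 0 <= bform Q x x by exact: pQ.
apply: le_trans (cY _) _; rewrite mulrDl mul1r; apply: ler_wpDr => //.
rewrite -mulrA ler_wpM2l // bform1_sum mulr_suml; apply: ler_sum => i _.
apply: le_trans (_ : bform Q (delta_mx i 0) (delta_mx i 0) * bform Q x x <= _).
  by rewrite -bform_delta psd_cauchy_schwarz.
by rewrite bform_delta -colE mxE.
Qed.

(* The N-orthogonal projection P onto ker Q splits N(x) = N(Px) + N(x - Px), and
   Q dominates the second summand. *)
Lemma psd_perturb_pd n (Q N : 'M[R]_n) : symmx Q -> psdmx Q -> symmx N ->
  (forall x, x != 0 -> Q *m x = 0 -> 0 < bform N x x) ->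
  exists2 e, 0 < e & pdmx (Q + e *: N).
Proof.
move=> sQ pQ sN kerN.
(* Since Q is symmetric, the columns of [U] form a basis of ker Q. *)
pose U := (row_base (kermx Q))^T.
have QU : Q *m U = 0.
  apply: trmx_inj; rewrite trmx_mul trmxK sQ trmx0; apply/sub_kermxP.
  by rewrite (eq_row_base (kermx Q)).
have injU u : U *m u = 0 -> u = 0.
  move=> Uu; have /row_freeP [D CD] := row_base_free (kermx Q).
  by rewrite -[u]mul1mx -[1%:M]trmx1 -CD trmx_mul -mulmxA Uu mulmx0.
have kerU x : Q *m x = 0 -> exists y, x = U *m y.
  move=> Qx; have : (x^T <= row_base (kermx Q))%MS.
    by rewrite (eq_row_base (kermx Q)); apply/sub_kermxP; rewrite -[Q]sQ -trmx_mul Qx trmx0.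
  by case/submxP=> D xD; exists D^T; rewrite -trmx_mul -xD trmxK.
have pG : pdmx (U^T *m N *m U).
  move=> u u0; rewrite -/(bform _ _ _) bform_congr; apply: kerN.
    by apply: contra_neq u0; apply: injU.
  by rewrite mulmxA QU mul0mx.
have uG : U^T *m N *m U \in unitmx by rewrite unitmxE unitfE pd_det_neq0.
pose P := U *m (invmx (U^T *m N *m U) *m (U^T *m N)).
have PU : P *m U = U by rewrite /P -!mulmxA (mulmxA U^T) mulVmx ?mulmx1.
have UNP : U^T *m N *m P = U^T *m N by rewrite /P !mulmxA mulmxV ?mul1mx.
pose T := (1%:M - P)^T *m (- N) *m (1%:M - P).
have sT : symmx T by rewrite /symmx /T !trmx_mul trmxK mulmxA linearN /= sN.
have QT x : Q *m x = 0 -> T *m x = 0.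
  case/kerU => y ->; rewrite /T mulmxA -(mulmxA _ (1%:M - P)) mulmxBl mul1mx PU.
  by rewrite subrr mulmx0 mul0mx.
have [c c0 cT] := psd_dominates sQ pQ sT (QT _).
have split x : bform N x x = bform N (P *m x) (P *m x) - bform T x x.
  have -> : bform T x x = - bform N (x - P *m x) (x - P *m x).
    by rewrite bform_congr bform_opp mulmxBl mul1mx.
  have orth : bform N (P *m x) (x - P *m x) = 0.
    have UNx : U^T *m N *m (x - P *m x) = 0 by rewrite mulmxBr mulmxA UNP subrr.
    have : bform N (U *m (invmx (U^T *m N *m U) *m (U^T *m N) *m x)) (x - P *m x) = 0.
      by rewrite /bform trmx_mul -(mulmxA _ U^T) -(mulmxA _ _ (x - _)) UNx mulmx0 mxE.
    by rewrite [U *m _]mulmxA.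
  by rewrite opprK -(bform_orthD sN orth) addrC subrK.
have p0 x : 0 <= bform N (P *m x) (P *m x).
  by rewrite /P -mulmxA -bform_congr; apply: pd_psd pG _.
(* For this e, e T(x) <= Q(x)/2, so (Q + e N)(x) >= Q(x)/2 + e N(Px). If Q(x) = 0, then Px = x and
   the second term is positive. *)
exists ((2 * c)^-1); first by rewrite invr_gt0 mulr_gt0.
move=> x x0; rewrite -/(bform _ _ _) bform_add bform_scale split.
have q0 : 0 <= bform Q x x by exact: pQ.
have e0 : 0 < (2 * c)^-1 by rewrite invr_gt0 mulr_gt0.
have et : (2 * c)^-1 * bform T x x <= bform Q x x / 2.
  apply: le_trans (ler_wpM2l (ltW e0) (cT x)) _.
  by rewrite le_eqVlt; apply/orP; left; apply/eqP; field; rewrite gt_eqF.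
rewrite mulrBr; have := mulr_ge0 (ltW e0) (p0 x).
have [qz _|qN] := eqVneq (bform Q x x) 0; last first.
  have : 0 < bform Q x x by rewrite lt_def qN.
  by move: et; lra.
have Qx := psd_ker sQ pQ qz.
have Px : P *m x = x by have [y ->] := kerU _ _ Qx; rewrite mulmxA PU.
have := mulr_gt0 e0 (kerN x x0 Qx); rewrite Px; move: et; rewrite qz; lra.
Qed.
End BilinearForms.

(** * Matrix pencils M - aN and their polynomial dependence on a *)

Section Pencils.
Set Implicit Arguments.
Unset Strict Implicit.
Unset Printing Implicit Defensive.
Variable R : realFieldType.

(* With A = [c b^T; b W]: the vector (det W, - adj(W) b), that is det W times the
   minimiser (1, - W^-1 b) of the form over vectors with first coordinate 1. *)
Definition schurvec (K : comPzRingType) n (A : 'M[K]_(1 + n)) : 'cV[K]_(1 + n) :=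
  col_mx (\det (drsubmx A))%:M (- (\adj (drsubmx A) *m dlsubmx A)).

Lemma map_schurvec (K L : comPzRingType) (f : {rmorphism K -> L}) n
  (A : 'M[K]_(1 + n)) : map_mx f (schurvec A) = schurvec (map_mx f A).
Proof.
rewrite /schurvec map_col_mx map_scalar_mx map_mxN map_mxM map_mx_adj.
by rewrite -det_map_mx map_drsubmx map_dlsubmx.
Qed.

Definition poly_pencil n (M N : 'M[R]_n) : 'M[{poly R}]_n :=
  map_mx polyC M - 'X *: map_mx polyC N.

Lemma horner_pencil n (M N : 'M[R]_n) a :
  map_mx (horner_eval a) (poly_pencil M N) = M - a *: N.
Proof.
by apply/matrixP=> i j; rewrite !mxE /horner_eval !hornerE.
Qed.

Lemma det_pencil_poly n (M N : 'M[R]_n) :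
  exists p : {poly R}, forall a, p.[a] = \det (M - a *: N).
Proof.
exists (\det (poly_pencil M N)) => a.
by rewrite -(horner_pencil M N) det_map_mx.
Qed.

(** [schurvec] is built from ring operations only, so it commutes with evaluation of a polynomial
    pencil. The separate pair A, B allows both M - aN itself and N alone to be evaluated along the
    moving vector. *)
Lemma schurvec_pencil_poly n (A B M N : 'M[R]_(1 + n)) :
  exists p : {poly R}, forall a, p.[a] =
    bform (A - a *: B) (schurvec (M - a *: N)) (schurvec (M - a *: N)).
Proof.
pose v := schurvec (poly_pencil M N).
exists ((v^T *m poly_pencil A B *m v) 0 0) => a.
rewrite /bform -!(horner_pencil _ _ a) -map_schurvec map_trmx -!map_mxM.
by rewrite [RHS]mxE.
Qed.

Lemma symmx_pencil n (M N : 'M[R]_n) a : symmx M -> symmx N -> symmx (M - a *: N).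
Proof. by move=> sM sN; rewrite /symmx linearB linearZ /= sM sN. Qed.

Lemma symmx_dr m n (A : 'M[R]_(m + n)) : symmx A -> symmx (drsubmx A).
Proof. by move=> sA; rewrite /symmx trmx_drsub sA. Qed.

Lemma drsubmx_pencil m n (M N : 'M[R]_(m + n)) a :
  drsubmx (M - a *: N) = drsubmx M - a *: drsubmx N.
Proof. by apply/matrixP=> i j; rewrite !mxE. Qed.

Lemma bform_dr m n (A : 'M[R]_(m + n)) u v :
  bform (drsubmx A) u v = bform A (col_mx 0 u) (col_mx 0 v).
Proof.
rewrite /bform -[in RHS](submxK A) tr_col_mx mul_row_block mul_row_col trmx0.
by rewrite !mul0mx !mulmx0 !add0r.
Qed.

Lemma col_mx0_neq0 m n (w : 'cV[R]_n) : w != 0 -> col_mx (0 : 'cV[R]_m) w != 0.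
Proof. by move=> w0; rewrite col_mx_eq0 negb_and w0 orbT. Qed.

Lemma pd_dr m n (A : 'M[R]_(m + n)) : pdmx A -> pdmx (drsubmx A).
Proof.
by move=> pA w w0; rewrite -/(bform _ _ _) bform_dr; apply/pA/col_mx0_neq0.
Qed.

(** The lower block vanishes because W adj(W) = det(W) I. *)
Lemma mul_schurvec n (A : 'M[R]_(1 + n)) :
  exists d : R, A *m schurvec A = col_mx d%:M 0.
Proof.
exists ((ulsubmx A *m (\det (drsubmx A))%:M +
   ursubmx A *m - (\adj (drsubmx A) *m dlsubmx A)) 0 0).
rewrite -{1}(submxK A) mul_block_col -mx11_scalar; congr col_mx.
by rewrite mulmxN mulmxA mul_mx_adj mul_mx_scalar mul_scalar_mx subrr.
Qed.

Lemma schurvec_neq0 n (A : 'M[R]_(1 + n)) :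
  \det (drsubmx A) != 0 -> schurvec A != 0.
Proof.
move=> d0; rewrite col_mx_eq0 negb_and; apply/orP; left.
by apply: contra_neq d0 => /matrixP /(_ 0 0); rewrite !mxE mulr1n.
Qed.

(* Vectors (0, w) are A-orthogonal to schurvec A, so the form splits along the line
   spanned by schurvec A and its complement. *)
Lemma schurvec_pd n (A : 'M[R]_(1 + n)) : symmx A -> pdmx (drsubmx A) ->
  0 < bform A (schurvec A) (schurvec A) -> pdmx A.
Proof.
move=> sA pW sv0 x x0; rewrite -/(bform _ _ _).
have d0 := pd_det_neq0 pW.
pose k := usubmx x 0 0 / \det (drsubmx A).
have [w xE] : exists w, x = k *: schurvec A + col_mx 0 w.
  exists (dsubmx x - k *: dsubmx (schurvec A)).
  rewrite -[x in LHS]vsubmxK -[schurvec A]vsubmxK scale_col_mx add_col_mx.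
  rewrite col_mxKd addr0 [k *: _ + (_ - _)]addrC subrK; congr col_mx.
  rewrite col_mxKu [usubmx x]mx11_scalar scale_scalar_mx /k divfK //.
have orth : bform A (k *: schurvec A) (col_mx 0 w) = 0.
  rewrite bformZl (bformC _ _ sA) /bform -mulmxA.
  have [d ->] := mul_schurvec A.
  by rewrite tr_col_mx mul_row_col trmx0 mul0mx mulmx0 addr0 mxE mulr0.
rewrite xE bform_orthD // bformZl bformZr mulrA -expr2 -bform_dr.
have [k0|kN] := eqVneq k 0.
  rewrite k0 expr0n mul0r add0r; apply: pW.
  by apply: contra_neq x0 => w0; rewrite xE k0 w0 scale0r col_mx0 addr0.
have k2 : 0 < k ^+ 2 by rewrite exprn_even_gt0.
apply: ltr_pwDl; first exact: mulr_gt0.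
exact: pd_psd pW _.
Qed.

(** The value of the form is det(W) d, where d is the only possibly nonzero entry of A [schurvec A].
    If it vanishes then d = 0, and [schurvec A] is a nonzero kernel vector. *)
Lemma schurvec_isotropic n (A : 'M[R]_(1 + n)) : \det (drsubmx A) != 0 ->
  bform A (schurvec A) (schurvec A) = 0 -> symmx A -> \det A = 0.
Proof.
move=> d0; have [d dE] := mul_schurvec A.
rewrite /bform -mulmxA dE tr_col_mx mul_row_col mulmx0 addr0 tr_scalar_mx.
rewrite -scalar_mxM mxE mulr1n => /eqP; rewrite mulf_eq0 (negPf d0) /= => /eqP dz sA.
apply/eqP/det0P; exists (schurvec A)^T.
  by rewrite -trmx0 (inj_eq trmx_inj) schurvec_neq0.
by apply: trmx_inj; rewrite trmx_mul trmxK sA dE dz raddf0 col_mx0 trmx0.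
Qed.

Lemma pencil_limit_psd n (M N : 'M[R]_n) a b : a < b ->
  (forall t, a <= t < b -> psdmx (M - t *: N)) -> psdmx (M - b *: N).
Proof.
move=> ab pt x; rewrite -/(bform _ _ _) bform_pencil leNgt; apply/negP=> neg.
pose e := b * bform N x x - bform M x x.
(* The form at x is affine in the parameter with slope at most [k] in absolute value. Moving back
   from b by at most e/(2k) keeps its value at or below -e/2. *)
pose k := `|bform N x x| + 1.
have k0 : 0 < k by rewrite ltr_wpDl.
have e0 : 0 < e by rewrite /e; lra.
pose t := Num.max a (b - e / (2 * k)).
have ek : 0 < e / (2 * k) by rewrite divr_gt0 // mulr_gt0.
have tb : t < b by rewrite gt_max ab /=; lra.
have := pt t; rewrite tb le_max lexx => /(_ isT x).
rewrite -/(bform _ _ _) bform_pencil leNgt => /negP; apply.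
have bt : b - t <= e / (2 * k) by rewrite lerBlDl -lerBlDr le_max lexx orbT.
have : (b - t) * bform N x x <= e / 2.
  apply: le_trans (_ : (b - t) * k <= _).
    by rewrite ler_wpM2l ?subr_ge0 1?ltW // ltr_pwDr // ler_norm.
  apply: le_trans (ler_wpM2r (ltW k0) bt) _.
  by rewrite le_eqVlt; apply/orP; left; apply/eqP; field; rewrite gt_eqF.
rewrite /e in e0 *; lra.
Qed.

End Pencils.

(** * Finsler's theorem over a real closed field *)

Section Finsler.
Set Implicit Arguments.
Unset Strict Implicit.
Unset Printing Implicit Defensive.
Variable R : rcfType.

Lemma poly_pos_no_root (p : {poly R}) a b : a <= b ->
  (forall x, a <= x <= b -> p.[x] != 0) -> 0 < p.[a] -> 0 < p.[b].
Proof.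
move=> ab nr pa; rewrite ltNge; apply/negP => pb.
have : (- p).[a] <= 0 <= (- p).[b] by rewrite !hornerN; lra.
case/(poly_ivt ab) => x /nr px; rewrite /root hornerN oppr_eq0.
by rewrite (negPf px).
Qed.

Lemma first_root (p : {poly R}) a : p.[a] != 0 ->
  (forall x, a <= x -> p.[x] != 0) \/
  (exists b, [/\ a < b, p.[b] = 0 & forall x, a <= x < b -> p.[x] != 0]).
Proof.
move=> pa; have [|nex] := classic (exists2 c, a <= c & p.[c] = 0); last first.
  by left=> x ax; apply/eqP => px; apply: nex; exists x.
(* The endpoint c + 1 places the known root c inside the open search interval, which rules out the
   rootless case. *)
case=> c ac pc; right; have [p0|y p0 py|d p0 _ noroot] := next_rootP p a (c + 1).
- by rewrite p0 horner0 eqxx in pa.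
- rewrite in_itv /= => /andP [ay _] noroot; exists y; split=> // x /andP [ax xy].
  move: ax; rewrite le_eqVlt => /predU1P [<- //|ax].
  by apply: noroot; rewrite in_itv /= ax.
have ac' : a < c by rewrite lt_neqAle ac andbT; apply: contraNneq pa => ->; rewrite pc.
have := noroot c; rewrite in_itv /= ac' ltrDl ltr01 => /(_ isT).
by rewrite /root pc eqxx.
Qed.

(** Algebraic substitute for continuity of eigenvalues, by induction on the dimension. As long as
    the restricted determinant [p] is nonzero, the restriction stays positive definite, and the
    value at [schurvec] cannot vanish without the full determinant vanishing. At a first root c <= b
    of [p] the pencil would be a nonsingular semidefinite limit, hence definite, and so would its
    restriction, contradicting p(c) = 0. *)
Lemma pencil_pd_continuation n (M N : 'M[R]_n) a b : symmx M -> symmx N ->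
  a <= b -> pdmx (M - a *: N) ->
  (forall t, a <= t <= b -> \det (M - t *: N) != 0) -> pdmx (M - b *: N).
Proof.
elim: n M N b => [|n IH] M N b sM sN ab pa nr.
  by move=> v; rewrite [v]flatmx0 eqxx.
rewrite -[n.+1]/(1 + n)%N in M N sM sN pa nr *.
have [p pE] := det_pencil_poly (drsubmx M) (drsubmx N).
have sQ t := symmx_pencil t sM sN.
have pWa : pdmx (drsubmx M - a *: drsubmx N) by rewrite -drsubmx_pencil; apply: pd_dr.
have key t : a <= t <= b -> (forall s, a <= s <= t -> p.[s] != 0) ->
    pdmx (M - t *: N).
  case/andP=> le_at tb pt.
  have dW s : a <= s <= t -> \det (drsubmx (M - s *: N)) != 0.
    by move=> /pt; rewrite pE drsubmx_pencil.
  apply: schurvec_pd => //.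
    rewrite drsubmx_pencil; apply: IH => //; try exact: symmx_dr.
    by move=> s /dW; rewrite drsubmx_pencil.
  have [g gE] := schurvec_pencil_poly M N M N.
  rewrite -gE; apply: (poly_pos_no_root le_at).
    move=> s ast; rewrite gE; apply/eqP => /schurvec_isotropic.
    move=> /(_ (dW s ast) (sQ s)) /eqP; apply/negP/nr.
    by case/andP: ast => -> st /=; apply: le_trans tb.
  rewrite gE; apply: pa; apply: schurvec_neq0; apply: dW; exact/andP.
have [|nor|[c [ac pc nor]]] := @first_root p a.
- by rewrite pE pd_det_neq0.
- by apply: key; rewrite ?ab ?lexx // => s /andP [as_ _]; apply: nor.
have [cb|bc] := leP c b; last first.
  apply: key; rewrite ?ab ?lexx // => s /andP [as_ sb]; apply: nor.
  by rewrite as_ (le_lt_trans sb bc).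
have : pdmx (M - c *: N).
  apply: psd_det_pd => //; last by apply: nr; rewrite (ltW ac).
  apply: (pencil_limit_psd ac) => t /andP [le_at tc]; apply/pd_psd/key.
    by rewrite le_at (le_trans (ltW tc) cb).
  by move=> s /andP [as_ st]; apply: nor; rewrite as_ (le_lt_trans st tc).
move/pd_dr/pd_det_neq0; rewrite drsubmx_pencil -pE pc eqxx //.
Qed.

(* If Q = M - a N is nonpositive at x and y, then, up to replacing y by -y, it is
   nonpositive on the segment from x to y, so N cannot vanish there. *)
Lemma pencil_cone_sign n (M N : 'M[R]_n) a x y : symmx M -> symmx N ->
  (forall z, z != 0 -> bform N z z = 0 -> 0 < bform M z z) ->
  bform (M - a *: N) x x <= 0 -> bform (M - a *: N) y y <= 0 ->
  bform N x x < 0 -> 0 < bform N y y -> False.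
Proof.
move=> sM sN H Qx Qy Nx Ny.
wlog Qxy : y Qy Ny / bform (M - a *: N) x y <= 0.
  move=> W; have [|] := leP (bform (M - a *: N) x y) 0; first exact: W.
  move=> Qxy; apply: (W (-1 *: y)); rewrite !(bformZl, bformZr); lra.
pose X0 := bform N x x; pose XY := bform N x y; pose Y0 := bform N y y.
pose p : {poly R} := X0 *: (1%:P - 'X) ^+ 2 + (2 * XY) *: ('X * (1%:P - 'X)) + Y0 *: 'X ^+ 2.
have pE s : p.[s] = bform N ((1 - s) *: x + s *: y) ((1 - s) *: x + s *: y).
  rewrite /p !(hornerD, hornerN, hornerZ, horner_exp, hornerM, hornerX, hornerC).
  rewrite !(bformDl, bformDr, bformZl, bformZr) (bformC y x sN).
  rewrite -/X0 -/XY -/Y0; ring.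
have [|s /andP [s0 s1]] := @poly_ivt _ p 0 1 ler01.
  by rewrite !pE subr0 subrr !scale1r !scale0r addr0 add0r !ltW.
rewrite /root pE; set z := _ + _ => /eqP Nz.
(* If z = 0 then (1-s)^2 N(x) = s^2 N(y), impossible since N(x) < 0 < N(y). *)
have [z0|zN] := eqVneq z 0.
  have sx : (1 - s) *: x = - (s *: y) by apply/eqP; rewrite -addr_eq0; apply/eqP.
  have : (1 - s) ^+ 2 * X0 = s ^+ 2 * Y0.
    have := congr1 (fun u => bform N u u) sx.
    by rewrite /= -scaleNr !(bformZl, bformZr) -/X0 -/Y0 => E; lra.
  have [s00|sneq0] := eqVneq s 0.
    by rewrite s00 subr0 expr1n mul1r expr0n mul0r => E; rewrite -/X0 E ltxx in Nx.
  have : 0 < s ^+ 2 * Y0 by rewrite mulr_gt0 ?exprn_even_gt0.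
  have : (1 - s) ^+ 2 * X0 <= 0 by rewrite mulr_ge0_le0 ?sqr_ge0 ?ltW.
  lra.
have := H z zN Nz; rewrite ltNge => /negP; apply.
have -> : bform M z z = bform (M - a *: N) z z.
  by rewrite bform_pencil Nz mulr0 subr0.
have sQ := symmx_pencil a sM sN.
rewrite /z !(bformDl, bformDr, bformZl, bformZr) (bformC y x sQ).
move: (bform _ x x) (bform _ x y) (bform _ y y) Qx Qxy Qy => u v w u0 v0 w0.
have s2 : 0 <= 1 - s by rewrite subr_ge0.
have := mulr_ge0_le0 s2 (mulr_ge0_le0 s2 u0).
have := mulr_ge0_le0 s2 (mulr_ge0_le0 s0 v0).
have := mulr_ge0_le0 s0 (mulr_ge0_le0 s0 w0).
lra.
Qed.

Lemma finsler_upward n (M N : 'M[R]_(1 + n)) a : symmx M -> symmx N ->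
  (forall x, x != 0 -> bform N x x = 0 -> 0 < bform M x x) ->
  pdmx (drsubmx (M - a *: N)) ->
  bform N (schurvec (M - a *: N)) (schurvec (M - a *: N)) < 0 ->
  exists t, pdmx (M - t *: N).
Proof.
move=> sM sN H pWa Na; apply: NNPP => noPD.
have sQ t := symmx_pencil t sM sN.
have cone t x y := @pencil_cone_sign _ M N t x y sM sN H.
have [p pE] := det_pencil_poly (drsubmx M) (drsubmx N).
have nonneg_case x t : x != 0 -> bform (M - t *: N) x x <= 0 -> bform N x x != 0.
  move=> x0 Qx; apply/eqP => Nx; have := H x x0 Nx.
  by move: Qx; rewrite bform_pencil Nx mulr0 subr0 leNgt => /negP.
(* Without a definite member of the pencil, [schurvec] stays in the nonpositive cone, where N does
   not vanish; being polynomial in the parameter, N there keeps its negative sign. *)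
have below t : a <= t -> (forall s, a <= s <= t -> p.[s] != 0) ->
    pdmx (drsubmx (M - t *: N)) /\
    exists x, bform (M - t *: N) x x <= 0 /\ bform N x x < 0.
  move=> le_at nr.
  have pW s : a <= s <= t -> pdmx (drsubmx (M - s *: N)).
    case/andP=> as_ st; rewrite drsubmx_pencil.
    apply: (@pencil_pd_continuation _ _ _ a); rewrite -?drsubmx_pencil //; try exact: symmx_dr.
    by move=> r /andP [ar rs]; rewrite -pE nr // ar (le_trans rs st).
  have Qle s : a <= s <= t -> bform (M - s *: N) (schurvec (M - s *: N))
      (schurvec (M - s *: N)) <= 0.
    move=> ast; rewrite leNgt; apply/negP=> pos; apply: noPD; exists s.
    by apply: schurvec_pd pos => //; apply: pW.
  split; first by apply: pW; rewrite le_at lexx.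
  exists (schurvec (M - t *: N)); split; first by apply: Qle; rewrite le_at lexx.
  have [g gE] := schurvec_pencil_poly (- N) 0 M N.
  have gN s : g.[s] = - bform N (schurvec (M - s *: N)) (schurvec (M - s *: N)).
    by rewrite gE scaler0 subr0 bform_opp.
  rewrite -oppr_gt0 -gN; apply: (poly_pos_no_root le_at); last by rewrite gN oppr_gt0.
  move=> s ast; rewrite gN oppr_eq0; apply: (nonneg_case _ s); last exact: Qle.
  by apply/schurvec_neq0/pd_det_neq0/pW.
have [|nor|[b [ab pb nor]]] := @first_root p a.
- by rewrite pE -drsubmx_pencil pd_det_neq0.
(* No root beyond a: a vector y with N(y) > 0 enters the nonpositive cone for large t, against
   [cone]. So -N is semidefinite, -N + eM is definite for some e > 0, and dividing by e gives a
   definite pencil member. *)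
- have Nle y : bform N y y <= 0.
    rewrite leNgt; apply/negP=> Ny.
    pose t := Num.max a (bform M y y / bform N y y).
    have le_at : a <= t by rewrite le_max lexx.
    have [_ [x [Qx Nx]]] := below t le_at (fun s ast => nor s (andP ast).1).
    apply: (cone t x y) => //; rewrite bform_pencil subr_le0 -ler_pdivrMr //.
    by rewrite le_max lexx orbT.
  have sNN : symmx (- N) by rewrite /symmx linearN /= sN.
  have pNN : psdmx (- N) by move=> x; rewrite -/(bform _ _ _) bform_opp oppr_ge0.
  have [|e e0 pe] := psd_perturb_pd sNN pNN sM.
    by move=> x x0 Nx; apply: H => //; rewrite -[N]opprK bform_opp bform_kerr ?oppr0.
  apply: noPD; exists e^-1 => x x0.
  have := pe x x0; rewrite -!/(bform _ _ _) bform_pencil bform_add bform_scale bform_opp.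
  move=> h; rewrite -(pmulr_rgt0 _ e0) mulrBr mulVKf ?gt_eqF //; lra.
have nrb t : t < b -> forall s, a <= s <= t -> p.[s] != 0.
  by move=> tb s /andP [as_ st]; apply: nor; rewrite as_ (le_lt_trans st tb).
have sWb := symmx_dr (sQ b).
have pWb : psdmx (drsubmx (M - b *: N)).
  rewrite drsubmx_pencil; apply: (pencil_limit_psd ab) => t /andP [le_at tb].
  have [pt _] := below t le_at (nrb t tb).
  by rewrite -drsubmx_pencil; apply: pd_psd.
have [k k0 Qk] : exists2 k : 'cV[R]_n, k != 0 & drsubmx (M - b *: N) *m k = 0.
  have /eqP/det0P [v v0 vQ] : \det (drsubmx (M - b *: N)) = 0 by rewrite drsubmx_pencil -pE.
  exists v^T; first by rewrite -trmx0 (inj_eq trmx_inj).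
  by rewrite -[drsubmx _]sWb -trmx_mul vQ trmx0.
pose y := col_mx (0 : 'cV[R]_1) k.
have y0 : y != 0 by exact: col_mx0_neq0.
have Qy : bform (M - b *: N) y y = 0 by rewrite -bform_dr bform_kerr.
(* The pencil at y is positive at a and zero at b, and the drop equals (b - a) N(y). *)
have Ny : 0 < bform N y y.
  have := pWa k k0; rewrite -/(bform _ _ _) bform_dr -/y => Qa.
  have : 0 < (b - a) * bform N y y.
    by move: Qy Qa; rewrite !bform_pencil; lra.
  by rewrite pmulr_rgt0 // subr_gt0.
have pos x : x != 0 -> bform (M - b *: N) x x <= 0 -> 0 < bform N x x.
  move=> x0 Qx; rewrite lt_neqAle eq_sym (nonneg_case x b) //= leNgt.
  by apply/negP=> Nx; apply: (cone b x y) => //; rewrite Qy.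
have [[x Qx]|psd] := classic (exists x, bform (M - b *: N) x x < 0).
  have x0 : x != 0.
    by apply: contraTneq Qx => ->; rewrite bform_kerr ?mulmx0 ?ltxx.
  have Nx := pos x x0 (ltW Qx).
  (* The second argument is the parameter where the form at x reaches zero. Hence x is still in the
     nonpositive cone at some t < b, where [below] supplies a vector with the opposite sign of N. *)
  pose t := Num.max a (b + bform (M - b *: N) x x / bform N x x).
  have le_at : a <= t by rewrite le_max lexx.
  have tb : t < b.
    by rewrite gt_max ab /= gtrDl pmulr_llt0 ?invr_gt0.
  have [_ [z [Qz Nz]]] := below t le_at (nrb t tb).
  apply: (cone t z x) => //.
  have : b + bform (M - b *: N) x x / bform N x x <= t by rewrite le_max lexx orbT.
  rewrite -lerBrDl ler_pdivrMr // !bform_pencil; lra.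
have pQ : psdmx (M - b *: N).
  by move=> x; rewrite -/(bform _ _ _) leNgt; apply/negP=> Qx; apply: psd; exists x.
(* The pencil at b is semidefinite and N is positive on its kernel, so stepping back to b - e makes
   it definite. *)
have [|e e0 pe] := psd_perturb_pd (sQ b) pQ sN.
  by move=> x x0 Qx; apply: pos => //; rewrite bform_kerr.
apply: noPD; exists (b - e).
by have -> : M - (b - e) *: N = M - b *: N + e *: N by rewrite scalerBl opprB addrA addrAC.
Qed.

Theorem finsler n (M N : 'M[R]_n) : symmx M -> symmx N ->
  (forall x, x != 0 -> bform N x x = 0 -> 0 < bform M x x) ->
  exists a, pdmx (M - a *: N).
Proof.
elim: n M N => [|n IH] M N sM sN H.
  by exists 0 => v; rewrite [v]flatmx0 eqxx.
rewrite -[n.+1]/(1 + n)%N in M N sM sN H *.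
have [||x x0 Nx|a pWa] := IH (drsubmx M) (drsubmx N); try exact: symmx_dr.
  by rewrite bform_dr; apply: H; rewrite -?bform_dr // col_mx0_neq0.
rewrite -drsubmx_pencil in pWa.
have [pos|npos] := ltP 0 (bform (M - a *: N) (schurvec (M - a *: N)) (schurvec (M - a *: N))).
  by exists a; apply: schurvec_pd pos => //; apply: symmx_pencil.
have sv0 : schurvec (M - a *: N) != 0 by apply/schurvec_neq0/pd_det_neq0.
have [Nn|Np|Nz] := ltgtP (bform N (schurvec (M - a *: N)) (schurvec (M - a *: N))) 0.
- exact: finsler_upward pWa Nn.
(* Replacing (a, N) by (-a, -N) preserves the pencil and reverses the direction of search. *)
- have E : M - a *: N = M - (- a) *: (- N) by rewrite scalerN scaleNr opprK.
  have [|||||t pt] := @finsler_upward n M (- N) (- a); rewrite -?E //.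
  + by rewrite /symmx linearN /= sN.
  + move=> x x0; rewrite bform_opp => /eqP; rewrite oppr_eq0 => /eqP; exact: H.
  + by rewrite bform_opp oppr_lt0.
  by exists (- t); rewrite scaleNr -scalerN.
have := H _ sv0 Nz; move: npos; rewrite bform_pencil Nz mulr0 subr0.
by rewrite leNgt => /negP.
Qed.

End Finsler.

(** * Quadratic matrix inequalities and interpolation in Z_r(N) *)

Section QuadraticMatrixInequalities.
Set Implicit Arguments.
Unset Strict Implicit.
Unset Printing Implicit Defensive.

Variable R : realFieldType.

Lemma bform_quadZ q r (P : 'M[R]_(q + r)) (Z : 'M[R]_(r, q)) v :
  bform (quadZ P Z) v v = bform P (col_mx v (Z *m v)) (col_mx v (Z *m v)).
Proof. by rewrite bform_congr mul_col_mx mul1mx. Qed.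

Lemma bform_block_diag q r (A : 'M[R]_q) (B : 'M[R]_r) v w :
  bform (block_mx A 0 0 B) (col_mx v w) (col_mx v w) = bform A v v + bform B w w.
Proof.
rewrite /bform tr_col_mx mul_row_block !mulmx0 addr0 add0r mul_row_col.
by rewrite mxE.
Qed.

Lemma bform_scalar n a (v : 'cV[R]_n) : bform a%:M v v = a * bform 1%:M v v.
Proof. by rewrite -[a%:M]scalemx1 bform_scale. Qed.

Lemma starP q r (M N : 'M[R]_(q + r)) alpha beta :
  star M N alpha beta <-> forall v w, beta * bform 1%:M v v <=
    bform (M - alpha *: N) (col_mx v w) (col_mx v w).
Proof.
have E v w : (((col_mx v w)^T *m (M - alpha *: N -
    block_mx (beta%:M : 'M_q) 0 0 (0 : 'M_r)) *m col_mx v w) 0 0) =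
  bform (M - alpha *: N) (col_mx v w) (col_mx v w) - beta * bform 1%:M v v.
  rewrite -/(bform _ _ _) bform_add bform_opp bform_block_diag bform_scalar.
  by rewrite [bform 0 _ _]bform_kerr ?mul0mx // addr0.
split=> [st v w|st x]; first by rewrite -subr_ge0 -E; apply: st.
by rewrite -[x]vsubmxK E subr_ge0.
Qed.

Lemma star_Zset_pos q r (M N : 'M[R]_(q + r)) alpha beta Z :
  0 <= alpha -> 0 < beta -> star M N alpha beta -> Zset N Z -> Zset_pos M Z.
Proof.
move=> a0 b0 st NZ v v0; rewrite -/(bform _ _ _) bform_quadZ.
set x := col_mx _ _.
have := NZ v; rewrite -/(bform _ _ _) bform_quadZ -/x => Nx.
have /starP /(_ v (Z *m v)) := st; rewrite -/x bform_pencil.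
have := mulr_gt0 b0 (bform1_gt0 v0); have := mulr_ge0 a0 Nx; lra.
Qed.

(** By Cauchy-Schwarz f = v^T S / S(v,v) works; if S(v,v) = 0 the bound is trivial and f = v^T /
    |v|^2 suffices. *)
Lemma normalized_functional n (S : 'M[R]_n) v : symmx S -> psdmx S -> v != 0 ->
  exists f : 'rV[R]_n, f *m v = 1%:M /\
    forall u, ((f *m u) 0 0) ^+ 2 * bform S v v <= bform S u u.
Proof.
move=> sS pS v0; have pS' u : 0 <= bform S u u by exact: pS.
have [Sv|SvN] := eqVneq (bform S v v) 0.
  exists ((bform 1%:M v v)^-1 *: v^T); split; last by move=> u; rewrite Sv mulr0.
  rewrite -scalemxAl [v^T *m v]mx11_scalar scale_scalar_mx /bform mulmx1 mulVf //.
  by have := gt_eqF (bform1_gt0 v0); rewrite /bform mulmx1 => ->.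
have Sv : 0 < bform S v v by rewrite lt_def SvN pS'.
exists ((bform S v v)^-1 *: (v^T *m S)); split.
  by rewrite -scalemxAl [_ *m v]mx11_scalar scale_scalar_mx mulVf.
move=> u; rewrite -scalemxAl mxE -/(bform S v u).
have := psd_cauchy_schwarz v u sS pS; rewrite mulrC => cs.
rewrite exprMn [_ * bform S v u ^+ 2]mulrC -mulrA.
rewrite [_ ^+ 2 * bform S v v](_ : _ = (bform S v v)^-1); last by field.
by rewrite ler_pdivrMr.
Qed.

(* Completing the square: K satisfies N22 K = N21. *)
Lemma PiSet_square q r (N : 'M[R]_(q + r)) : PiSet N ->
  exists (K : 'M[R]_(r, q)) (S : 'M[R]_q), [/\ symmx S, psdmx S &
    forall v w, bform N (col_mx v w) (col_mx v w) =
      bform S v v + bform (blk22 N) (w + K *m v) (w + K *m v)].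
Proof.
case=> sN n22 schur kerN; have [X pX] := pinv_exists (blk22 N).
have pS := schur X pX; case: pX => AXA _ _ _.
have sA : (blk22 N)^T = blk22 N by rewrite trmx_drsub sN.
have s11 : (blk11 N)^T = blk11 N by rewrite trmx_ulsub sN.
have s12 : (blk12 N)^T = blk21 N by rewrite trmx_ursub sN.
have BXA : blk12 N *m X *m blk22 N = blk12 N.
  apply/eqP; rewrite eq_sym -subr_eq0 -[Y in Y - _]mulmx1 -mulmxA -mulmxBr.
  apply/eqP/mulmx_cV_eq0 => x; rewrite -mulmxA; apply: kerN.
  by rewrite mulmxA mulmxBr mulmx1 mulmxA AXA subrr mul0mx.
pose K := X^T *m blk21 N.
have AK : blk22 N *m K = blk21 N.
  by have := congr1 trmx BXA; rewrite !trmx_mul sA s12.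
have KA : K^T *m blk22 N = blk12 N by rewrite trmx_mul trmxK -s12 trmxK BXA.
have SE : blk11 N - blk12 N *m X *m blk21 N = blk11 N - K^T *m blk22 N *m K.
  by rewrite -AK !mulmxA BXA KA.
clearbody K; rewrite SE in pS.
exists K, (blk11 N - K^T *m blk22 N *m K); split=> //.
  by rewrite /symmx linearB /= s11 !trmx_mul sA trmxK mulmxA.
move=> v w; rewrite -[K^T *m _ *m K]scale1r bform_pencil mul1r bform_congr.
rewrite !(bformDl, bformDr) [bform _ w (K *m v)](bformC _ _ sA).
rewrite /bform -{1}(submxK N) tr_col_mx mul_row_block mul_row_col !mulmxDl.
rewrite -!/(blk11 _) -!/(blk12 _) -!/(blk21 _) -!/(blk22 _).
have addE (a b : 'M[R]_1) : (a + b) 0 0 = a 0 0 + b 0 0 by rewrite mxE.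
rewrite !addE.
have -> : (w^T *m blk21 N *m v) 0 0 = ((K *m v)^T *m blk22 N *m w) 0 0.
  rewrite -AK; transitivity (bform (blk22 N) w (K *m v)); last exact: bformC.
  by rewrite /bform !mulmxA.
have -> : (v^T *m blk12 N *m w) 0 0 = ((K *m v)^T *m blk22 N *m w) 0 0.
  by rewrite trmx_mul -KA !mulmxA.
ring.
Qed.

(** With y = w + Kv, the matrix Z = y f - K sends v to w, and N at (u, Zu) is S(u) + f(u)^2 N22(y)
    >= f(u)^2 (S(v) + N22(y)) >= 0. *)
Lemma PiSet_interpolation q r (N : 'M[R]_(q + r)) v w : PiSet N -> v != 0 ->
  0 <= bform N (col_mx v w) (col_mx v w) -> exists2 Z, Zset N Z & Z *m v = w.
Proof.
move=> PN v0; have [K [S [sS pS NE]]] := PiSet_square PN; rewrite NE.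
have [f [fv fS]] := normalized_functional sS pS v0.
set y := w + K *m v => Ny.
exists (y *m f - K); last by rewrite mulmxBl -mulmxA fv mulmx1 addrK.
move=> u; rewrite -/(bform _ _ _) bform_quadZ NE mulmxBl subrK -mulmxA.
rewrite [f *m u]mx11_scalar mul_mx_scalar bformZl bformZr mulrA -expr2.
have := fS u; have := sqr_ge0 ((f *m u) 0 0).
move: (_ ^+ 2) => a a0 aS; have := mulr_ge0 a0 Ny; rewrite mulrDr; lra.
Qed.

Lemma PiSet_Zset_nonempty q r (N : 'M[R]_(q + r)) v : PiSet N ->
  exists w, 0 <= bform N (col_mx v w) (col_mx v w).
Proof.
move=> PN; have [K [S [_ pS NE]]] := PiSet_square PN.
exists (- (K *m v)); rewrite NE addNr [bform _ 0 _]bform_kerr ?mulmx0 // addr0.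
exact: pS.
Qed.

Lemma npsd_ker n (A : 'M[R]_n) u : symmx A -> lemx A 0 ->
  0 <= bform A u u -> A *m u = 0.
Proof.
move=> sA; rewrite /lemx sub0r => nA Au.
have sNA : symmx (- A) by rewrite /symmx linearN /= sA.
apply: oppr_inj; rewrite oppr0 -mulNmx; apply: psd_ker => //.
by apply/eqP; rewrite eq_le nA andbT bform_opp oppr_le0.
Qed.

End QuadraticMatrixInequalities.

(** * The strict S-lemma and the kernel of N22 *)

Section StrictSLemma.
Set Implicit Arguments.
Unset Strict Implicit.
Unset Printing Implicit Defensive.

(** If Finsler's multiplier a is negative, then 0 works as well: where N(x) < 0, M(x) > a N(x) >
    0. *)
Lemma strict_s_lemma (R : rcfType) n (M N : 'M[R]_n) : symmx M -> symmx N ->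
  (forall x, x != 0 -> 0 <= bform N x x -> 0 < bform M x x) ->
  exists2 a, 0 <= a & pdmx (M - a *: N).
Proof.
move=> sM sN H; have [|a pa] := finsler sM sN.
  by move=> x x0 Nx; apply: H; rewrite ?Nx.
have [a0|a0] := leP 0 a; first by exists a.
exists 0 => // x x0; rewrite scale0r subr0 -/(bform _ _ _).
have [/H|Nx] := leP 0 (bform N x x); first exact.
have := pa x x0; rewrite -/(bform _ _ _) bform_pencil.
have : 0 < a * bform N x x by rewrite nmulr_rgt0.
lra.
Qed.

Variable R : realFieldType.

Lemma bform_block_ker q r (P : 'M[R]_(q + r)) (z : 'cV[R]_r) :
  blk12 P *m z = 0 -> blk22 P *m z = 0 -> P *m col_mx 0 z = 0.
Proof.
move=> z12 z22; rewrite -[P]submxK mul_block_col !mulmx0 !add0r.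
by rewrite -/(blk12 _) -/(blk22 _) z12 z22 col_mx0.
Qed.

Lemma quadratic_pos_nonpos_lead (a b c : R) : c <= 0 ->
  (forall t, 0 < a + 2 * t * b + t ^+ 2 * c) -> c = 0 /\ b = 0.
Proof.
move=> c0 pos; have a0 : 0 < a by have := pos 0; lra.
have cz : c = 0.
  apply/eqP; rewrite eq_le c0 /= leNgt; apply/negP=> cn.
  (* The values at s and -s add up to 2(a + s^2 c), and a + s^2 c <= c < 0 for this s. *)
  pose s := a / (- c) + 1.
  have s1 : 1 <= s by rewrite lerDr divr_ge0 // ?ltW // oppr_gt0.
  have sc : s * - c = a - c by rewrite mulrDl mul1r divfK // oppr_eq0 lt_eqF.
  have := pos s; have := pos (- s); nra.
split=> //; apply/eqP; apply: contraT => b0.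
by have := pos (- a / b); rewrite cz [2 * _ * b](_ : _ = - 2 * a); [lra | field].
Qed.

(* Along z in ker N22 the form N is constant on x + t z, so M stays positive there;
   with M22 <= 0 this forces M to vanish along z. *)
Lemma ker_blk22_sub_ker q r (M N : 'M[R]_(q + r)) (z : 'cV[R]_r) (v0 : 'cV[R]_q) :
  symmx M -> lemx (blk22 M) 0 -> PiSet N -> v0 != 0 ->
  (forall (v : 'cV[R]_q) (w : 'cV[R]_r), v != 0 -> 0 <= bform N (col_mx v w) (col_mx v w) ->
     0 < bform M (col_mx v w) (col_mx v w)) ->
  blk22 N *m z = 0 -> M *m col_mx 0 z = 0.
Proof.
move=> sM nM PN v00 pos z22.
have [sN _ _ kerN] := PN.
have Nz : N *m col_mx 0 z = 0 by apply: bform_block_ker => //; apply: kerN.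
have sM22 : symmx (blk22 M) := symmx_dr sM.
have key (v : 'cV[R]_q) : v != 0 -> bform (blk22 M) z z = 0 /\
    exists w, bform M (col_mx v w) (col_mx 0 z) = 0.
  move=> vN; have [w Nw] := PiSet_Zset_nonempty v PN.
  have [|t|cz bz] := @quadratic_pos_nonpos_lead (bform M (col_mx v w) (col_mx v w))
    (bform M (col_mx v w) (col_mx 0 z)) (bform M (col_mx 0 z) (col_mx 0 z)).
  - rewrite -bform_dr; have := nM z; rewrite -/(bform _ _ _) sub0r bform_opp.
    by rewrite oppr_ge0.
  - have E : col_mx v (w + t *: z) = col_mx v w + t *: col_mx 0 z.
      by rewrite scale_col_mx scaler0 add_col_mx addr0.
    have : 0 < bform M (col_mx v (w + t *: z)) (col_mx v (w + t *: z)).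
      apply: pos => //; rewrite E !(bformDl, bformDr, bformZl, bformZr).
      rewrite [bform N (col_mx 0 z) _](bformC _ _ sN) ![bform N _ (col_mx 0 z)]bform_kerr //.
      by rewrite !mulr0 !addr0.
    rewrite E !(bformDl, bformDr, bformZl, bformZr).
    by rewrite [bform M (col_mx 0 z) (col_mx v w)](bformC _ _ sM); lra.
  by split; [rewrite bform_dr | exists w].
have z22M : blk22 M *m z = 0.
  by apply: npsd_ker => //; rewrite (key v0 v00).1.
(* If v = M12 z were nonzero, [key] at this v would give 0 = v^T M12 z = |v|^2. *)
apply: bform_block_ker => //; apply/eqP; apply: contraT => vN.
have [_ [w]] := key _ vN; rewrite /bform -[in LHS](submxK M) -mulmxA mul_block_col.
rewrite -/(blk12 _) -/(blk22 _) z22M !mulmx0 !add0r tr_col_mx mul_row_col mulmx0.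
rewrite addr0 => /eqP; rewrite gt_eqF //.
by rewrite submxK; have := bform1_gt0 vN; rewrite /bform mulmx1.
Qed.

(** The orthogonal projection is 1 - XA, symmetric by one of the Penrose conditions on X. *)
Lemma ker_projector n (A : 'M[R]_n) : exists P : 'M[R]_n,
  [/\ P^T = P, P *m P = P, A *m P = 0 & forall x : 'cV_n, A *m x = 0 -> P *m x = x].
Proof.
have [X [AXA _ _ sXA]] := pinv_exists A.
have AP : A *m (1%:M - X *m A) = 0 by rewrite mulmxBr mulmx1 mulmxA AXA subrr.
exists (1%:M - X *m A); split=> //.
- by rewrite linearB /= trmx1 sXA.
- by rewrite mulmxBl mul1mx -mulmxA AP mulmx0 subr0.
by move=> x Ax; rewrite mulmxBl mul1mx -mulmxA Ax mulmx0 subr0.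
Qed.

Lemma pos_eigenvalue_vector n (A : 'M[R]_n) lam : 0 < lam -> eigenvalue A lam ->
  exists x, 0 < bform A x x.
Proof.
move=> l0 /eigenvalueP [v vA v0]; exists v^T.
rewrite /bform trmxK vA -scalemxAl mxE mulr_gt0 //.
have := @bform1_gt0 _ _ v^T; rewrite /bform trmxK mulmx1; apply.
by rewrite -trmx0 (inj_eq trmx_inj).
Qed.

End StrictSLemma.

(** * Necessity of the matrix inequality, and the final equivalence *)

Lemma Zset_sub_star (R : rcfType) q r (M N : 'M[R]_(q + r)) :
  symmx M -> PiSet N -> lemx (blk22 M) 0 ->
  (exists lam : R, 0 < lam /\ eigenvalue N lam) ->
  (forall Z, Zset N Z -> Zset_pos M Z) ->
  exists alpha beta : R, [/\ 0 <= alpha, 0 < beta & star M N alpha beta].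
Proof.
move=> sM PN nM [lam [l0 eig]] ZN.
have [sN n22 _ kerN] := PN.
have s22 : symmx (blk22 N) := symmx_dr sN.
have pos (v : 'cV[R]_q) (w : 'cV[R]_r) : v != 0 -> 0 <= bform N (col_mx v w) (col_mx v w) ->
    0 < bform M (col_mx v w) (col_mx v w).
  move=> v0 /(PiSet_interpolation PN v0) [Z /ZN ZM <-].
  by have := ZM v v0; rewrite -/(bform _ _ _) bform_quadZ.
(* The positive eigenvalue rules out q = 0: as N22 <= 0, a vector with N(x) > 0 has a nonzero top
   block. *)
have [v0 v00] : exists v0 : 'cV[R]_q, v0 != 0.
  have [x Nx] := pos_eigenvalue_vector l0 eig; exists (usubmx x).
  apply: contraTneq Nx => x0; rewrite -[x]vsubmxK x0 -bform_dr -leNgt.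
  by have := n22 (dsubmx x); rewrite -/(bform _ _ _) sub0r bform_opp oppr_ge0.
have [P [sP PP NP kerP]] := ker_projector (blk22 N).
have Mz (z : 'cV_r) : M *m col_mx 0 (P *m z) = 0.
  by apply: (ker_blk22_sub_ker sM nM PN v00 pos); rewrite mulmxA NP mul0mx.
have Nz (z : 'cV_r) : N *m col_mx 0 (P *m z) = 0.
  have z22 : blk22 N *m (P *m z) = 0 by rewrite mulmxA NP mul0mx.
  by apply: bform_block_ker => //; apply: kerN.
have PE w : bform P w w = bform 1%:M (P *m w) (P *m w).
  by rewrite -bform_congr mulmx1 sP PP.
pose G := block_mx (0 : 'M[R]_q) 0 0 P.
have GE v w : bform G (col_mx v w) (col_mx v w) = bform P w w.
  by rewrite bform_block_diag [bform 0 _ _]bform_kerr ?mul0mx // add0r.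
(* G makes M strictly positive on the common kernel {0} x ker N22 of M and N. *)
have sMG : symmx (M + G) by rewrite /symmx linearD /= sM tr_block_mx !trmx0 sP.
have [|a a0 pQ] := strict_s_lemma sMG sN.
  move=> x; rewrite -[x]vsubmxK; move: (usubmx x) (dsubmx x) => v w x0 Nx.
  rewrite bform_add GE PE; have [v0'|vN] := eqVneq v 0; last first.
    by rewrite ltr_pwDl ?pos ?bform1_ge0.
  rewrite v0' in x0 Nx *.
  have w0 : w != 0 by apply: contra_neq x0 => ->; rewrite col_mx0.
  (* N22 <= 0 and N22(w) >= 0 put w in ker N22, where M vanishes and [G] contributes |w|^2. *)
  have Pw : P *m w = w by apply/kerP/npsd_ker => //; rewrite bform_dr.
  rewrite Pw -{1 2}Pw bform_kerr ?Pw ?add0r ?bform1_gt0 //.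
  by rewrite -Pw.
have sQ := symmx_pencil a sMG sN.
have [c c0 cQ] : exists2 c, 0 < c & forall x, bform 1%:M x x <= c * bform (M + G - a *: N) x x.
  apply: psd_dominates => //; first exact: pd_psd.
    by rewrite /symmx trmx1.
  move=> x Qx; have [->|/pQ] := eqVneq x 0; first by rewrite mulmx0.
  by rewrite -mulmxA Qx mulmx0 mxE ltxx.
exists a, c^-1; rewrite invr_gt0; split=> //; apply/starP => v w.
(* Removing the component of w in ker N22 leaves the form of M - aN unchanged and makes [G] vanish,
   so the bound with [G] transfers to M - aN. *)
pose w1 := w - P *m w.
have Pw1 : P *m w1 = 0 by rewrite mulmxBr mulmxA PP subrr.
have xE : col_mx v w = col_mx v w1 + col_mx 0 (P *m w).
  by rewrite add_col_mx addr0 subrK.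
have Qz : (M - a *: N) *m col_mx 0 (P *m w) = 0.
  by rewrite mulmxBl -scalemxAl Mz Nz scaler0 subr0.
have sMN := symmx_pencil a sM sN.
rewrite xE bform_orthD ?(bform_kerr _ Qz) // addr0.
have -> : bform (M - a *: N) (col_mx v w1) (col_mx v w1) =
    bform (M + G - a *: N) (col_mx v w1) (col_mx v w1).
  by rewrite !bform_pencil bform_add GE PE Pw1 [bform 1%:M 0 _]bform_kerr ?mulmx0 // addr0.
rewrite ler_pdivrMl //; apply: le_trans (cQ _).
rewrite scalar_mx_block bform_block_diag.
by rewrite lerDl bform1_ge0.
Qed.

Theorem mainTheorem11 (R : rcfType) (q r : nat) (M N : 'M[R]_(q + r)) :
  symmx M -> symmx N ->
  ((exists alpha beta : R, [/\ 0 <= alpha, 0 < beta & star M N alpha beta]) ->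
     forall Z : 'M[R]_(r, q), Zset N Z -> Zset_pos M Z)
  /\
  (PiSet N -> lemx (blk22 M) 0 ->
   (exists lam : R, 0 < lam /\ eigenvalue N lam) ->
   ((forall Z : 'M[R]_(r, q), Zset N Z -> Zset_pos M Z) <->
    (exists alpha beta : R, [/\ 0 <= alpha, 0 < beta & star M N alpha beta]))).
Proof.
move=> sM sN.
have star_sub : (exists alpha beta : R, [/\ 0 <= alpha, 0 < beta & star M N alpha beta]) ->
    forall Z : 'M[R]_(r, q), Zset N Z -> Zset_pos M Z.
  by move=> [a [b [a0 b0 st]]] Z; apply: star_Zset_pos a0 b0 st.
split=> // PN nM eig; split=> // ZN; exact: Zset_sub_star.
Qed.
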